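(* Let $a=(a_0,a_1,a_2,\dots)$ be a real sequence with $a_0>0$ and let $\omega=a^{(-1)}=(\omega_0,\omega_1,\dots)$ be its convolution inverse. Then $a$ is completely monotone if and only if the following three conditions hold: $\omega_0>0$; the sequence $(-\omega_1,-\omega_2,-\omega_3,\dots)$ is completely monotone; and $\omega_0+\sum_{j=1}^{\infty}\omega_j\ge 0$. Moreover (in this case), $\omega_0+\sum_{j=1}^\infty\omega_j=\|a\|_{\ell^1}^{-1}$, where $\|a\|_{\ell^1}=\sum_{j\ge 0}|a_j|$ and $\|a\|_{\ell^1}^{-1}$ is interpreted as $0$ if $\|a\|_{\ell^1}=\infty$.
   Context: A real sequence $v=(v_0,v_1,\dots)$ is completely monotone if $((I-E)^jv)_k\ge 0$ for all $j,k\ge 0$, where $(Ev)_k=v_{k+1}$. The convolution of sequences is $(u*v)_n=\sum_{j=0}^n u_jv_{n-j}$, with identity $\delta_d=(1,0,0,\dots)$; the convolution inverse $a^{(-1)}$ of a sequence $a$ with $a_0\neq0$ is the unique sequence with $a*a^{(-1)}=\delta_d$. *)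

(* Defs.v *)
From mathcomp Require Import all_boot all_order all_algebra.
From mathcomp Require Import all_classical all_reals all_analysis.

Set Implicit Arguments.
Unset Strict Implicit.
Unset Printing Implicit Defensive.

Import Order.TTheory GRing.Theory Num.Theory.
Import numFieldNormedType.Exports.

Local Open Scope ring_scope.

Definition seq_shift (R : realType) (v : R^nat) : R^nat := fun k => v k.+1.

(* (I - E) v, with E the shift *)
Definition seq_diff (R : realType) (v : R^nat) : R^nat :=
  fun k => v k - seq_shift v k.

Definition completely_monotone (R : realType) (v : R^nat) : Prop :=
  forall j k : nat, 0 <= iter j (@seq_diff R) v k.

Definition conv (R : realType) (u v : R^nat) : R^nat :=
  fun n => \sum_(j < n.+1) u j * v (n - j)%N.

Definition conv_id (R : realType) : R^nat := fun n => (n == 0%N)%:R.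

Definition is_conv_inverse (R : realType) (a w : R^nat) : Prop :=
  conv a w = @conv_id R.

(* +oo when the series diverges *)
Definition l1_norm (R : realType) (a : R^nat) : \bar R :=
  (\sum_(0 <= j <oo) `|a j|%:E)%E.

Lemma conv_inverse_exists (R : realType) (a : R^nat) :
  a 0%N != 0 -> exists w : R^nat, is_conv_inverse a w.
Proof.
move=> a0.
pose c n (s : seq R) :=
  (conv_id R n - \sum_(j < n) a j.+1 * nth 0 s j) / a 0%N.
pose p := fix p n := if n is m.+1 then c m (p m) :: p m else [::].
have pE n j : (j < n)%N -> nth 0 (p n) j = c (n - j.+1)%N (p (n - j.+1)%N).
  elim: n j => [//|n IH] [|j] /=; first by rewrite subSS subn0.
  by rewrite ltnS subSS => /IH.
exists (fun n => c n (p n)); apply/funext => n.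
rewrite /conv big_ord_recl subn0 {1}/c mulrC divfK //.
rewrite -addrA [X in _ + X](_ : _ = 0) ?addr0 // addrC; apply/eqP.
by rewrite subr_eq0; apply/eqP/eq_bigr => j _; rewrite pE.
Qed.

Lemma conv_inverse_unique (R : realType) (a w w' : R^nat) :
  a 0%N != 0 -> is_conv_inverse a w -> is_conv_inverse a w' -> w = w'.
Proof.
move=> a0 aw aw'; apply/funext => n; elim/ltn_ind: n => n IH.
have := congr1 (fun f : R^nat => f n) (etrans aw (esym aw')).
rewrite /conv !big_ord_recl subn0.
rewrite [X in _ + X = _](_ : _ = \sum_(i < n) a (lift ord0 i) *
  w' (n - lift ord0 i)%N); last first.
  apply: eq_bigr => j _; rewrite IH // lift0.
  by rewrite ltn_subrL /= (leq_ltn_trans _ (ltn_ord j)).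
by move/addIr/(mulfI a0).
Qed.

(* Main.v *)
Require Import Defs.
From HB Require Import structures.
From mathcomp Require Import all_boot all_order all_algebra.
From mathcomp Require Import all_classical all_reals all_analysis.
From mathcomp Require Import ring lra.

(** The idea is that of Hilbert space operators. A completely monotone [a] has
    the form [a k = <e, T^k e>] with [T] self-adjoint and [0 <= T <= 1]; its
    generating function is [A(z) = <e, (1 - z T)^-1 e>], and the Schur
    complement formula says that [1/A(z) = w_0 - z b(z)], where, up to a
    positive factor, [b k = <f, S^k f>] with [f = T^(1/2) e] and
    [S = T^(1/2) P T^(1/2)] for the projection [P] to the complement of [e], so
    that again [0 <= S <= 1]. Going back, [b] and [w_0] are
    glued to an operator that contains that of [b] as a block, and the
    positivity of [1 - T] is exactly the condition [w_0 >= b_0 + b_1 + ...].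

    All this takes place on polynomials, without any completion. The only
    analytic input is that the functional [moment v] sending ['X^k] to [v k] is
    nonnegative on polynomials nonnegative on the unit interval as soon as [v]
    is completely monotone ([moment_ge0]); this is proved with Bernstein sums.
    In the other direction, [completely_monotone_contraction] produces complete
    monotonicity from a symmetric form and a symmetric operator squeezed
    between [0] and the identity.

    A single operator serves both directions: for a sequence [g], multiplication
    by ['X] followed by the projection onto the kernel of [moment g] along the
    constants ([mulX_proj g]). The constant terms of the orbit of [1] under it
    are, up to the factor [g 0], the convolution inverse of [g]
    ([mulX_proj_iter0]). With [g = a] this gives
    [inverse_completely_monotone], with [g] the inverse of [a] it gives
    [completely_monotone_inverse]; only the symmetric form differs.

    For the value of the series, let [A n] and [W n] be the partial sums of [a]
    and of its inverse. Convolving [a * w = delta] with the constant sequence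
    [1] gives [\sum_(j <= n) a j * W (n - j) = 1], and since [W] is
    nonincreasing, [W n] is trapped between the inverse of the norm of [a] and
    the inverse of [A n] ([cvg_inverse_psum]). *)

Import Order.TTheory GRing.Theory Num.Theory.
Import numFieldNormedType.Exports.

Set Implicit Arguments.
Unset Strict Implicit.
Unset Printing Implicit Defensive.

Local Open Scope ring_scope.

(** * The moment functional of a sequence *)

Definition moment (R : realType) (v : R^nat) (p : {poly R}) : R :=
  \sum_(i < size p) p`_i * v i.

Lemma moment_wide (R : realType) (v : R^nat) (p : {poly R}) (N : nat) :
  (size p <= N)%N -> moment v p = \sum_(i < N) p`_i * v i.
Proof.
move=> pN; rewrite /moment -!(big_mkord predT (fun i => p`_i * v i)).
rewrite (big_cat_nat _ pN) //= [X in _ = _ + X]big_nat_cond.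
rewrite [X in _ + X]big1 ?addr0 //.
by move=> i /andP[/andP[pi _] _]; rewrite nth_default ?mul0r.
Qed.

Lemma moment_is_scalar (R : realType) (v : R^nat) : scalar (moment v).
Proof.
move=> c p q; set N := maxn (size p) (size q).
have pN : (size p <= N)%N by exact: leq_maxl.
have qN : (size q <= N)%N by exact: leq_maxr.
have cpqN : (size (c *: p + q)%R <= N)%N.
  rewrite (leq_trans (size_polyD _ _)) // geq_max qN andbT.
  exact: leq_trans (size_scale_leq _ _) pN.
rewrite (moment_wide _ cpqN) (moment_wide _ pN) (moment_wide _ qN).
rewrite mulr_sumr -big_split; apply: eq_bigr => i _.
by rewrite coefD coefZ mulrDl mulrA.
Qed.

HB.instance Definition _ (R : realType) (v : R^nat) :=
  GRing.isLinear.Build R {poly R} R _ (moment v) (moment_is_scalar v).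

Lemma momentZ (R : realType) (v : R^nat) (c : R) (p : {poly R}) :
  moment v (c *: p) = c * moment v p.
Proof. exact: linearZ. Qed.

Lemma momentXn (R : realType) (v : R^nat) (k : nat) : moment v 'X^k = v k.
Proof.
rewrite (moment_wide _ (eq_leq (size_polyXn _ k))) big_ord_recr /=.
rewrite coefXn eqxx mul1r big1 ?add0r // => i _.
by rewrite coefXn ltn_eqF ?mul0r.
Qed.

Lemma moment1 (R : realType) (v : R^nat) : moment v 1 = v 0%N.
Proof. by rewrite -(momentXn v 0) expr0. Qed.

Lemma momentC (R : realType) (v : R^nat) (c : R) : moment v c%:P = c * v 0%N.
Proof. by rewrite -moment1 -momentZ alg_polyC. Qed.

Lemma momentXM (R : realType) (v : R^nat) (p : {poly R}) :
  moment v ('X * p) = moment (seq_shift v) p.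
Proof.
have Xp : (size ('X * p)%R <= (size p).+1)%N.
  by rewrite (leq_trans (size_polyMleq _ _)) // size_polyX.
rewrite (moment_wide _ Xp) big_ord_recl coefXM mul0r add0r.
by apply: eq_bigr => i _; rewrite coefXM.
Qed.

(** The shift acts on moments as multiplication by ['X], so the difference
    operator acts as multiplication by [1 - 'X]. *)
Lemma iter_seq_diffE (R : realType) (v : R^nat) (j k : nat) :
  iter j (@seq_diff R) v k = moment v ('X^k * (1 - 'X) ^+ j).
Proof.
elim: j k => [|j IH] k; first by rewrite expr0 mulr1 momentXn.
rewrite iterS /seq_diff /seq_shift !IH -linearB /=; congr moment.
by rewrite !exprS; ring.
Qed.

(** * Positivity on the unit interval *)

(** The [k]-th moment of the measure that puts at [j / n] the mass
    ['C(n, j) * moment v ('X^j * (1 - 'X)^(n - j))], i.e., the value of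
    [moment v] on the [n]-th Bernstein polynomial of [x |-> x^k]. *)
Definition bernstein_moment (R : realType) (v : R^nat) (n k : nat) : R :=
  \sum_(j < n.+1) iter (n - j) (@seq_diff R) v j *+ 'C(n, j) *
    (j%:R / n%:R) ^+ k.

(** The Bernstein basis is a partition of unity, by the binomial formula for
    ['X + (1 - 'X)]. *)
Lemma bernstein_moment0 (R : realType) (v : R^nat) (n : nat) :
  bernstein_moment v n 0 = v 0%N.
Proof.
rewrite /bernstein_moment -(momentXn v 0) expr0.
have <- : (1 - 'X + 'X) ^+ n = 1 :> {poly R} by rewrite subrK expr1n.
rewrite exprDn linear_sum; apply: eq_bigr => j _ /=.
by rewrite expr0 mulr1 iter_seq_diffE linearMn /= mulrC.
Qed.

(** Dual to [p |-> 'X * (1 - 'X) * p^`()]: the moment of ['X^i] becomes that of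
    [i * ('X^i - 'X^(i + 1))]. *)
Definition seq_derive (R : realType) (v : R^nat) : R^nat :=
  fun i => i%:R * seq_diff v i.

(** The sequence form of [x (1 - x) B' = (j - (m + j) x) B] for the Bernstein
    polynomial [B = x^j (1 - x)^m]. *)
Lemma iter_seq_diff_derive (R : realType) (v : R^nat) (m j : nat) :
  iter m (@seq_diff R) (seq_derive v) j =
  j%:R * iter m (@seq_diff R) v j -
  (m + j)%:R * iter m (@seq_diff R) (seq_shift v) j.
Proof.
have shiftE i : iter m (@seq_diff R) (seq_shift v) i =
                iter m (@seq_diff R) v i.+1.
  by rewrite !iter_seq_diffE -momentXM exprS mulrA.
rewrite shiftE {shiftE}; elim: m j => [|m IH] j.
  by rewrite /= /seq_derive /seq_diff /seq_shift; ring.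
rewrite !iterS {1}/seq_diff /seq_shift !IH /seq_diff /seq_shift.
by rewrite addSn -!natr1 !natrD -!natr1; ring.
Qed.

(** Multiplying the Bernstein polynomial of index [j] by its node [j / n]
    amounts to multiplying it by [x] and adding [x (1 - x) / n] times its
    derivative. *)
Lemma bernstein_momentS (R : realType) (v : R^nat) (n k : nat) :
  bernstein_moment v n.+1 k.+1 =
  bernstein_moment (seq_shift v) n.+1 k +
  n.+1%:R^-1 * bernstein_moment (seq_derive v) n.+1 k.
Proof.
rewrite /bernstein_moment mulr_sumr -big_split /=; apply: eq_bigr => j _.
rewrite iter_seq_diff_derive subnK; last by rewrite -ltnS.
have n0 : n.+1%:R != 0 :> R by rewrite pnatr_eq0.
have distr (A A' t m y : R) c : m != 0 -> A *+ c * (t / m * y) =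
    A' *+ c * y + m^-1 * ((t * A - m * A') *+ c * y).
  move=> m0; rewrite -(mulr_natr A) -(mulr_natr A') -(mulr_natr (_ - _)).
  by field.
by rewrite exprS; exact: distr.
Qed.

Local Open Scope classical_set_scope.
(** Induction on [k] for all sequences at once: the recursion for [k + 1]
    involves two other sequences, and the second term carries a vanishing factor
    [1 / n]. *)
Lemma cvg_bernstein_moment (R : realType) (v : R^nat) (k : nat) :
  bernstein_moment v n.+1 k @[n --> \oo] --> v k.
Proof.
elim: k v => [|k IH] v.
  under eq_fun do rewrite bernstein_moment0; exact: cvg_cst.
under eq_fun do rewrite bernstein_momentS.
rewrite -[v k.+1]addr0 -(mul0r (seq_derive v k)).
apply: cvgD; first exact: IH.
apply: cvgM; last exact: IH.
exact: cvg_harmonic.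
Qed.
Local Close Scope classical_set_scope.

(** The positive half of the Hausdorff moment theorem: [moment v p] is the limit
    of the integrals of [p] against the discrete Bernstein measures, whose
    masses are iterated differences of [v] up to binomial factors. *)
Lemma moment_ge0 (R : realType) (v : R^nat) (p : {poly R}) :
  completely_monotone v -> (forall x, 0 <= x <= 1 -> 0 <= p.[x]) ->
  0 <= moment v p.
Proof.
move=> v_cm p_ge0.
pose u n := \sum_(i < size p) p`_i * bernstein_moment v n.+1 i.
have uE n : u n = \sum_(j < n.+2) iter (n.+1 - j) (@seq_diff R) v j
    *+ 'C(n.+1, j) * p.[j%:R / n.+1%:R].
  rewrite /u; under eq_bigr do rewrite mulr_sumr.
  rewrite exchange_big; apply: eq_bigr => j _ /=.
  by rewrite horner_coef mulr_sumr; apply: eq_bigr => i _; ring.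
have u_cvg : (u @ \oo --> moment v p)%classic.
  rewrite /u; apply: cvg_big; first exact: add_continuous.
  by move=> i _; apply: cvgMl_tmp; exact: cvg_bernstein_moment.
apply: (cvgr_to_ge u_cvg); apply: nearW => n; rewrite uE sumr_ge0 // => j _.
rewrite mulr_ge0 ?mulrn_wge0 ?v_cm ?p_ge0 //.
by rewrite divr_ge0 //= ler_pdivrMr ?ltr0n // mul1r ler_nat -ltnS.
Qed.

Lemma moment_sqr_ge0 (R : realType) (v : R^nat) (p : {poly R}) :
  completely_monotone v -> 0 <= moment v (p ^+ 2).
Proof.
move=> v_cm; apply: moment_ge0 => // x _.
by rewrite expr2 hornerM -expr2 sqr_ge0.
Qed.

Lemma moment_X1BX_sqr_ge0 (R : realType) (v : R^nat) (p : {poly R}) :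
  completely_monotone v -> 0 <= moment v ('X * (1 - 'X) * p ^+ 2).
Proof.
move=> v_cm; apply: moment_ge0 => // x /andP[x0 x1].
rewrite expr2 !hornerM -expr2 hornerX hornerD hornerN hornerX hornerC.
by rewrite mulr_ge0 ?sqr_ge0 // mulr_ge0 // subr_ge0.
Qed.

(** * Sequences of powers of a symmetric contraction *)

(** With [D = 1 - T], the iterated differences are [B e (T^k (D^j e))]. By
    symmetry pairs of factors [T] or [D] are moved to both sides of the form,
    which leaves exponents at most [1]; the mixed case uses
    [T D = D T D + T D T]. *)
Lemma completely_monotone_contraction (R : realType) (V : zmodType)
    (B : V -> V -> R) (T : V -> V) (e : V) :
  (forall u v, B u v = B v u) ->
  (forall u v w, B u (v - w) = B u v - B u w) ->
  {morph T : u v / u - v} ->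
  (forall u v, B u (T v) = B (T u) v) ->
  (forall u, 0 <= B u (T u) <= B u u) ->
  completely_monotone (fun k => B e (iter k T e)).
Proof.
move=> BC BB TB BT B_T j k.
pose D u := u - T u.
have TD u : T (D u) = D (T u) by rewrite /D TB.
have iterD i u : iter i D (T u) = T (iter i D u).
  by elim: i => //= i ->; rewrite TD.
have iterT i u : iter i T (D u) = D (iter i T u).
  by elim: i => //= i ->; rewrite TD.
have BD u v : B u (D v) = B (D u) v.
  by rewrite /D [RHS]BC !BB [B v u]BC BT [B (T u) v]BC.
have -> : iter j (@seq_diff R) (fun k => B e (iter k T e)) k =
          B e (iter k T (iter j D e)).
  elim: j k => [//|j IH] k.
  by rewrite iterS /seq_diff /seq_shift !IH -BB /= iterT.
have [N] := ubnP (k + j); elim: N => // N IH in e k j *.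
case: k => [|[|k]]; case: j => [|[|j]] kjN.
- by have /andP[Te_ge0] := B_T e; exact: le_trans.
- by have /andP[_ Te] := B_T e; rewrite /= /D BB subr_ge0.
- rewrite [iter j.+2 D e]iterS iterT BD [iter _ D e]iterSr; apply: IH.
  by rewrite !addnS ltnS in kjN; exact: ltnW.
- by have /andP[] := B_T e.
- have /andP[TDe_ge0 _] := B_T (D e).
  have DTe_ge0 : 0 <= B (T e) (D (T e)).
    by rewrite /D BB subr_ge0; case/andP: (B_T (T e)).
  (* B e x = B e (D x) + B e (T x); by symmetry these two terms are
     B (D e) (T (D e)) and B (T e) (D (T e)) *)
  rewrite /=; set x := T (D e).
  rewrite -[B e x](subrK (B e (T x))) -BB (BD e x) (BT e x).
  by rewrite addr_ge0 // /x TD.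
- rewrite [iter j.+2 D e]iterS iterT BD [iter _ D e]iterSr; apply: IH.
  by rewrite !addnS ltnS in kjN; exact: ltnW.
all: rewrite iterS BT iterSr -iterD; apply: IH.
all: by rewrite !addSn ltnS in kjN; exact: ltnW.
Qed.

(** * Multiplication by the variable, projected onto the kernel of moments *)

(** Subtracting this constant makes [moment g] vanish, see
    [moment_mulX_proj]. *)
Definition mulX_proj (R : realType) (g : R^nat) (p : {poly R}) : {poly R} :=
  'X * p - (moment g ('X * p) / g 0%N)%:P.

Lemma moment_mulX_proj (R : realType) (g : R^nat) (p : {poly R}) :
  g 0%N != 0 -> moment g (mulX_proj g p) = 0.
Proof. by move=> g0; rewrite linearB /= momentC divfK ?subrr. Qed.

Lemma horner_mulX_proj (R : realType) (g : R^nat) (p : {poly R}) :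
  (mulX_proj g p).[0] = - (moment g ('X * p) / g 0%N).
Proof. by rewrite !hornerE. Qed.

Lemma mulX_projB (R : realType) (g : R^nat) :
  {morph mulX_proj g : p q / p - q}.
Proof.
by move=> p q; rewrite /mulX_proj mulrBr linearB /= mulrBl polyCB; ring.
Qed.

Lemma conv_comm (R : realType) (u v : R^nat) : Defs.conv u v = Defs.conv v u.
Proof.
apply/funext => n; rewrite /Defs.conv (reindex_inj rev_ord_inj) /=.
by apply: eq_bigr => j _; rewrite subSS subKn 1?leq_ord // mulrC.
Qed.

(** Each step multiplies by ['X] and adds a constant, so the [n]-th iterate of
    [1] has as coefficients the constant terms [s] of the iterates up to [n], in
    reverse order. The vanishing of its moment is therefore the equation
    [conv g s n = 0]. *)
Lemma mulX_proj_iter0 (R : realType) (g w : R^nat) (k : nat) :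
  g 0%N != 0 -> is_conv_inverse g w ->
  (iter k (mulX_proj g) 1).[0] = g 0%N * w k.
Proof.
move=> g0 gw; pose s k := (iter k (mulX_proj g) 1).[0].
have iterE n : iter n (mulX_proj g) 1 = \sum_(j < n.+1) s j *: 'X^(n - j).
  elim: n => [|n IH]; first by rewrite big_ord1 /s /= hornerC scale1r expr0.
  rewrite big_ord_recr /= subnn expr0 alg_polyC.
  rewrite {2}/s /= horner_mulX_proj polyCN -/(iter n _ _).
  rewrite {1}/mulX_proj; congr (_ - _).
  rewrite {}IH mulr_sumr; apply: eq_bigr => j _.
  by rewrite subSn 1?leq_ord // exprS scalerAr.
have gs : is_conv_inverse g (fun n => s n / g 0%N).
  rewrite /is_conv_inverse conv_comm; apply/funext => n.
  have -> : Defs.conv (fun n => s n / g 0%N) g n =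
      moment g (iter n (mulX_proj g) 1) / g 0%N.
    rewrite iterE linear_sum mulr_suml; apply: eq_bigr => j _ /=.
    by rewrite momentZ momentXn mulrAC.
  case: n => [|n]; first by rewrite moment1 divff.
  by rewrite /= moment_mulX_proj // mul0r.
by rewrite (conv_inverse_unique g0 gw gs) mulrC divfK.
Qed.

(** * The inverse of a completely monotone sequence *)

(** For [M = moment a] the form is [M ('X p q)], divided by [(a 0)^2] so that
    its values on the orbit of [1] are exactly the negated tail of [w]. The
    operator [T = mulX_proj a] is symmetric for it, with
    [M ('X p (T p)) = M ((T p)^2)]. This is at most [M ('X p^2)] because it is
    [M ('X^2 p^2)] minus a nonnegative term, and [x^2 <= x] on the unit
    interval. *)
Lemma inverse_completely_monotone (R : realType) (a w : R^nat) :
  0 < a 0%N -> completely_monotone a -> is_conv_inverse a w ->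
  completely_monotone (fun k => - w k.+1).
Proof.
move=> a0 a_cm aw; have a_neq0 : a 0%N != 0 by rewrite gt_eqF.
pose M := moment a; pose T := mulX_proj a.
have MT p q : M ('X * (p * T q)) =
    M ('X * 'X * (p * q)) - M ('X * p) * M ('X * q) / a 0%N.
  have -> : 'X * (p * T q) =
      'X * 'X * (p * q) - (M ('X * q) / a 0%N) *: ('X * p).
    by rewrite /T /mulX_proj -mul_polyC; ring.
  by rewrite /M linearB /= momentZ; ring.
have M_TT p : M ('X * (p * T p)) = M (T p ^+ 2).
  rewrite MT; set m := M ('X * p).
  set k := m / a 0%N.
  have -> : T p ^+ 2 = 'X * 'X * (p * p) - (k *: ('X * p)) *+ 2 + (k ^+ 2)%:P.
    by rewrite /T /mulX_proj -/(M _) -/m -/k -mul_polyC rmorphXn /=; ring.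
  rewrite /M linearD linearB linearMn /= momentZ momentC -/(M _) -/m /k.
  by field.
have -> : (fun k => - w k.+1) =
    (fun k => M ('X * (1 * iter k T 1)) / a 0%N ^+ 2).
  apply/funext => k; have := mulX_proj_iter0 k.+1 a_neq0 aw.
  rewrite /= horner_mulX_proj -/T mul1r -/M => Mw.
  rewrite -[w _](mulKf a_neq0) -Mw; by field.
apply: (@completely_monotone_contraction R {poly R}
  (fun p q => M ('X * (p * q)) / a 0%N ^+ 2)) => [p q|p q r|p q|p q|p].
- by rewrite [p * q]mulrC.
- by rewrite !mulrBr /M linearB /= mulrBl.
- exact: mulX_projB.
- by rewrite [T p * q]mulrC !MT [q * p]mulrC; ring.
- apply/andP; split; rewrite ?ler_pM2r ?invr_gt0 ?exprn_gt0 //.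
    by rewrite divr_ge0 ?sqr_ge0 // M_TT moment_sqr_ge0 //.
  rewrite MT -subr_ge0 opprD opprK addrA addr_ge0 //; last first.
    by rewrite divr_ge0 -?expr2 ?sqr_ge0 // ltW.
  rewrite /M -linearB /=.
  have -> : 'X * (p * p) - 'X * 'X * (p * p) = 'X * (1 - 'X) * p ^+ 2 by ring.
  exact: moment_X1BX_sqr_ge0.
Qed.

(** * The inverse of a sequence with completely monotone negated tail *)

Lemma moment_XnM (R : realType) (v : R^nat) (n : nat) (p : {poly R}) :
  moment v ('X^n * p) = \sum_(i < size p) p`_i * v (n + i)%N.
Proof.
rewrite -{1}[p]coefK poly_def mulr_sumr linear_sum /=; apply: eq_bigr => i _.
by rewrite -scalerAr momentZ -exprD momentXn.
Qed.

Local Open Scope classical_set_scope.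
Lemma cvg_moment_XnM (R : realType) (v : R^nat) (p : {poly R}) :
  v @ \oo --> 0 -> moment v ('X^n * p) @[n --> \oo] --> 0.
Proof.
move=> v0; under eq_fun do rewrite moment_XnM.
suff: \sum_(i < size p) p`_i * v (n + i)%N @[n --> \oo] -->
      \sum_(i < size p) p`_i * 0.
  by rewrite [X in _ --> X]big1 // => i _; rewrite mulr0.
apply: cvg_big; first exact: add_continuous.
move=> i _; apply: cvgMl_tmp; have := v0; rewrite -(cvg_shiftn i) /=.
exact: cvg_trans.
Qed.

Lemma bounded_sums_cvg0 (R : realType) (v : R^nat) (s : R) :
  (forall n, 0 <= v n) -> (forall n, \sum_(i < n) v i <= s) ->
  v @ \oo --> 0.
Proof.
move=> v0 v_le; apply: cvg_series_cvg_0; apply: nondecreasing_is_cvgn.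
  by apply/nondecreasing_seqP => n; rewrite /series /= big_nat_recr //= lerDl.
by exists s => _ [n _ <-]; rewrite /series /= big_mkord.
Qed.
Local Close Scope classical_set_scope.

(** If [mu] represents [b], the difference of the two sides is at least the
    integral of [t (c - (1 - t) p)^2 / (1 - t)], because [s] bounds the integral
    of [1 / (1 - t)]. To avoid this denominator it is replaced by the truncated
    geometric series [h]; the error is a multiple of the moment of
    ['X^(n + 1) * p], which tends to [0]. *)
Lemma moment_sqr_perturb_le (R : realType) (b : R^nat) (s c : R)
    (p : {poly R}) :
  completely_monotone b -> (forall n, \sum_(i < n) b i <= s) ->
  moment b ((c%:P + 'X * p) ^+ 2) <= c ^+ 2 * s + moment b ('X * p ^+ 2).
Proof.
move=> b_cm b_le; set D := _ + moment b _.
have b_ge0 n : 0 <= b n := b_cm 0%N n.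
have step n : - (2 * c * moment b ('X^(n.+1) * p)) <=
    D - moment b ((c%:P + 'X * p) ^+ 2).
  pose h : {poly R} := \sum_(i < n) 'X^i.
  have Xh : ('X - 1) * h = 'X^n - 1 by rewrite -subrX1.
  have hE : c ^+ 2 * moment b (1 + 'X * h) <= c ^+ 2 * s.
    rewrite ler_wpM2l ?sqr_ge0 // (le_trans _ (b_le n.+1)) //.
    rewrite linearD /= moment1 big_ord_recl lerD2l.
    rewrite mulr_sumr linear_sum /=; apply: ler_sum => i _.
    by rewrite -exprS momentXn.
  have sq_ge0 := moment_X1BX_sqr_ge0 (p - c *: h) b_cm.
  have tail_ge0 : 0 <= c ^+ 2 * moment b ('X^(n.+1) * h).
    rewrite mulr_ge0 ?sqr_ge0 // moment_XnM sumr_ge0 // => i _.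
    rewrite mulr_ge0 // /h coef_sum sumr_ge0 // => j _.
    by rewrite coefXn.
  (* complete the square, using that (1 - 'X) * h = 1 - 'X^n *)
  have polyE : 'X * p ^+ 2 - (c%:P + 'X * p) ^+ 2 =
      'X * (1 - 'X) * (p - c *: h) ^+ 2 - (c *: ('X^(n.+1) * p)) *+ 2 +
      c ^+ 2 *: ('X^(n.+1) * h) - c ^+ 2 *: (1 + 'X * h).
    have Xn : 'X^n = 1 + ('X - 1) * h :> {poly R} by rewrite Xh addrC subrK.
    by rewrite -!mul_polyC rmorphXn /= (exprS _ n) Xn; ring.
  have := congr1 (moment b) polyE.
  rewrite linearB linearB linearD linearB linearMn /= !momentZ /D.
  move: (moment b ('X * _ * _)) sq_ge0 => S S_ge0.
  move: (moment b ('X^_ * h)) (moment b (1 + _)) tail_ge0 hE => H G H_ge0 GE.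
  lra.
rewrite -subr_ge0.
have := cvg_moment_XnM p (bounded_sums_cvg0 b_ge0 b_le).
rewrite -(cvg_shiftS (fun n => moment b ('X^n * p))) => tail.
have {}tail : (- (2 * c * moment b ('X^(n.+1) * p)) @[n --> \oo] -->
    - (2 * c * 0))%classic.
  by apply: cvgN; apply: cvgMl_tmp.
rewrite mulr0 oppr0 in tail.
by apply: (ler_cvg_to tail (cvg_cst _)); apply: nearW => n; exact: step.
Qed.

(** For [M = moment w] and [L] the moments of the negated tail of [w], the form
    [B p q = p(0) M q + q(0) M p - M (p q)] equals
    [w_0 p(0) q(0) + L ('X p1 q1)], where [p = p(0) + 'X p1] and likewise for
    [q]: it glues the constants to the space of [L]. The operator
    [T = mulX_proj w] has [M (T q) = 0], hence [B p (T q) = L (p q)], and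
    [B p (T p) <= B p p] is [moment_sqr_perturb_le]. *)
Lemma completely_monotone_inverse (R : realType) (a w : R^nat) :
  0 < w 0%N -> is_conv_inverse a w ->
  completely_monotone (fun k => - w k.+1) ->
  (forall n, \sum_(i < n) - w i.+1 <= w 0%N) -> completely_monotone a.
Proof.
move=> w0 aw b_cm b_le; have w_neq0 : w 0%N != 0 by rewrite gt_eqF.
have wa : is_conv_inverse w a by rewrite /is_conv_inverse conv_comm.
pose M := moment w; pose L := moment (fun k => - w k.+1); pose T := mulX_proj w.
have MX p : M ('X * p) = - L p.
  rewrite /M /L momentXM /moment -sumrN; apply: eq_bigr => i _.
  by rewrite mulrN opprK.
pose B p q := p.[0] * M q + q.[0] * M p - M (p * q).
have BT p q : B p (T q) = L (p * q).
  rewrite /B /T horner_mulX_proj {1}/M moment_mulX_proj // -/M !MX -/T.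
  have -> : p * T q = 'X * (p * q) + (L q / w 0%N) *: p.
    by rewrite /T /mulX_proj -/(M _) MX -mul_polyC mulNr polyCN; ring.
  by rewrite /M linearD /= momentZ -/(M _) -/(M _) MX; ring.
have BC p q : B p q = B q p by rewrite /B [q * p]mulrC; ring.
have -> : a = (fun k => B 1 (iter k T 1) / w 0%N ^+ 2).
  apply/funext => k; rewrite /B (mulX_proj_iter0 k w_neq0 wa) mul1r hornerC.
  by rewrite /M moment1; field.
apply: (@completely_monotone_contraction R {poly R}
  (fun p q => B p q / w 0%N ^+ 2)) => [p q|p q r|p q|p q|p].
- by rewrite BC.
- by rewrite /B mulrBr !hornerE /M !linearB /=; ring.
- exact: mulX_projB.
- by rewrite [B (T p) _]BC !BT [q * p]mulrC.
- apply/andP; split; rewrite ?ler_pM2r ?invr_gt0 ?exprn_gt0 // BT.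
    by rewrite divr_ge0 ?sqr_ge0 // -expr2 moment_sqr_ge0 //.
  pose c := p.[0]; pose q := drop_poly 1 p.
  have pE : p = c%:P + 'X * q.
    apply/polyP => -[|i]; rewrite coefD coefC coefXM /= /c.
      by rewrite horner_coef0 addr0.
    by rewrite add0r coef_drop_poly addn1.
  have := moment_sqr_perturb_le c q b_cm b_le.
  rewrite -pE expr2 => /le_trans; apply.
  have Mp : M p = c * w 0%N - L q.
    by rewrite {1}pE /M linearD /= momentC -/(M _) MX.
  have Mpp : M (p ^+ 2) = c ^+ 2 * w 0%N - (c * L q *+ 2 + L ('X * q ^+ 2)).
    have -> : p ^+ 2 = (c ^+ 2)%:P + 'X * ((c *: q) *+ 2 + 'X * q ^+ 2).
      by rewrite {1}pE -mul_polyC rmorphXn /=; ring.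
    by rewrite /M linearD /= momentC -/(M _) MX /L linearD linearMn /= momentZ.
  rewrite /B -/c -expr2 Mpp Mp -/(L _).
  lra.
Qed.

(** * The sum of the inverse *)

Definition psum (R : realType) (v : R^nat) (n : nat) : R := \sum_(i < n.+1) v i.

Lemma psumS (R : realType) (v : R^nat) (n : nat) :
  psum v n.+1 = psum v n + v n.+1.
Proof. by rewrite /psum big_ord_recr. Qed.

(** The sequence of partial sums is the convolution with the constant sequence
    [1], which is what [conv_id] becomes under the same operation. *)
Lemma conv_psum (R : realType) (a w : R^nat) (n : nat) :
  is_conv_inverse a w -> \sum_(j < n.+1) a j * psum w (n - j) = 1.
Proof.
move=> aw; have awE k : Defs.conv a w k = (k == 0%N)%:R by rewrite aw.
elim: n => [|n IH].
  by have := awE 0%N; rewrite /Defs.conv !big_ord1 /psum big_ord1.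
rewrite big_ord_recr /= subnn {2}/psum big_ord1.
under eq_bigr => j _.
  rewrite subSn 1?leq_ord // psumS mulrDr -subSn 1?leq_ord //; over.
rewrite big_split /= IH -addrA -[RHS]addr0; congr (_ + _).
by have := awE n.+1; rewrite /Defs.conv big_ord_recr /= subnn.
Qed.

Lemma psum_nonincreasing (R : realType) (v : R^nat) :
  (forall n, v n.+1 <= 0) -> {homo psum v : m n / (m <= n)%N >-> n <= m}.
Proof.
move=> v_le0; apply/nonincreasing_seqP => n.
by rewrite psumS gerDl.
Qed.

(** In the identity [conv_psum] every factor [psum w (n - j)] is at least
    [psum w n]. *)
Lemma inverse_psum_le (R : realType) (a w : R^nat) (n : nat) :
  is_conv_inverse a w -> (forall n, 0 <= a n) -> (forall n, w n.+1 <= 0) ->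
  psum a n * psum w n <= 1.
Proof.
move=> aw a_ge0 w_le0; rewrite -(conv_psum n aw) /psum mulr_suml.
apply: ler_sum => j _; rewrite ler_wpM2l //.
exact/(psum_nonincreasing w_le0)/leq_subr.
Qed.

(** In the identity [conv_psum] at [k + m], the first [k + 1] factors of
    [psum w] are at most [psum w m] and the others at most [w 0]. *)
Lemma inverse_psum_ge (R : realType) (a w : R^nat) (k m : nat) :
  is_conv_inverse a w -> (forall n, 0 <= a n) -> (forall n, w n.+1 <= 0) ->
  1 <= psum a k * psum w m + w 0%N * (psum a (k + m) - psum a k).
Proof.
move=> aw a_ge0 w_le0; have w_mono := psum_nonincreasing w_le0.
have psumE n : psum a n = \sum_(0 <= j < n.+1) a j by rewrite /psum big_mkord.
have kkm : (k.+1 <= (k + m).+1)%N by rewrite ltnS leq_addr.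
rewrite -(conv_psum (k + m) aw).
rewrite -(big_mkord predT (fun j => a j * psum w (k + m - j))).
rewrite !psumE !(big_cat_nat (leq0n k.+1) kkm) //= [_ + _ - _]addrC addKr.
rewrite mulr_suml mulr_sumr; apply: lerD; apply: ler_sum_nat => j /andP[kj jk].
  by rewrite ler_wpM2l // w_mono // addnC -addnBA ?leq_addr.
rewrite mulrC ler_wpM2r //.
have -> : w 0%N = psum w 0 by rewrite /psum big_ord1.
exact: w_mono.
Qed.

Local Open Scope classical_set_scope.

Lemma cvg_psum_l1_norm (R : realType) (a : R^nat) :
  (forall n, 0 <= a n) -> (psum a n)%:E @[n --> \oo] --> l1_norm a.
Proof.
move=> a_ge0.
have psumE n : (psum a n)%:E = (\sum_(0 <= j < n.+1) `|a j|%:E)%E.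
  rewrite sumEFin big_mkord /psum; congr _%:E.
  by apply: eq_bigr => i _; rewrite ger0_norm.
under eq_fun do rewrite psumE.
have : cvgn (fun n => (\sum_(0 <= j < n) `|a j|%:E)%E).
  by apply: is_cvg_nneseries => n _ _; rewrite lee_fin.
by rewrite -(cvg_shiftS (fun n => (\sum_(0 <= j < n) `|a j|%:E)%E)).
Qed.

(** When the norm is finite, letting [k] tend to infinity in [inverse_psum_ge]
    kills the last term and bounds [psum w m] below by the inverse of the norm.
    When it is infinite that term stays bounded, [a] being nonincreasing, while
    [psum a k] is unbounded, so [psum w m] cannot be negative. Together with
    [inverse_psum_le] this squeezes [psum w]. *)
Lemma cvg_inverse_psum (R : realType) (a w : R^nat) :
  0 < a 0%N -> is_conv_inverse a w ->
  (forall n, 0 <= a n) -> (forall n, a n.+1 <= a n) ->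
  (forall n, w n.+1 <= 0) ->
  (psum w n)%:E @[n --> \oo] --> ((l1_norm a)^-1)%E.
Proof.
move=> a0 aw a_ge0 a_dec w_le0.
have w_ub n := inverse_psum_le n aw a_ge0 w_le0.
have w_lb k m := inverse_psum_ge k m aw a_ge0 w_le0.
have w0 : 0 < w 0%N.
  have := conv_psum 0 aw; rewrite big_ord1 /psum big_ord1 => aw0.
  by rewrite -(pmulr_rgt0 _ a0) aw0.
have psum_ge n : a 0%N <= psum a n.
  by rewrite /psum big_ord_recl lerDl sumr_ge0.
have psum_gt0 n : 0 < psum a n := lt_le_trans a0 (psum_ge n).
have {}w_ub n : psum w n <= (psum a n)^-1.
  by rewrite -[leRHS]mul1r ler_pdivlMr // mulrC.
have l1_ge0 : (0 <= l1_norm a)%E.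
  by apply: nneseries_ge0 => n _ _; rewrite lee_fin.
have := cvg_psum_l1_norm a_ge0.
case: (l1_norm a) l1_ge0 => [l| |] // _ al.
- have {}al : psum a n @[n --> \oo] --> l by exact: (fine_cvg al).
  have l_gt0 : 0 < l.
    by apply: (lt_le_trans a0); apply: (cvgr_to_ge al); exact: nearW.
  have w_ge m : l^-1 <= psum w m.
    rewrite -[leLHS]mul1r ler_pdivrMr // mulrC.
    have lim : psum a k * psum w m + w 0%N * (psum a (k + m) - psum a k)
        @[k --> \oo] --> l * psum w m + w 0%N * (l - l).
      apply: cvgD; first exact: cvgMr_tmp.
      apply: cvgMl_tmp; apply: cvgB => //.
      by have := al; rewrite -(cvg_shiftn m).
    rewrite -[leRHS]addr0 -(mulr0 (w 0%N)) -(subrr l).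
    by apply: (cvgr_to_ge lim); apply: nearW.
  rewrite inver gt_eqF //; apply: cvg_EFin; first exact: nearW.
  apply: (squeeze_cvgr (f := cst l^-1) (h := fun n => (psum a n)^-1)).
  + by apply: nearW => n; rewrite w_ub w_ge.
  + exact: cvg_cst.
  + by apply: cvgV => //; rewrite gt_eqF.
- have {}al : psum a n @[n --> \oo] --> +oo by apply/cvgeryP.
  have w_ge m : 0 <= psum w m.
    rewrite leNgt; apply/negP => wm_lt0.
    have tail k : psum a (k + m) - psum a k <= m%:R * a 0%N.
      elim: m {wm_lt0} => [|m IH]; first by rewrite addn0 subrr mul0r.
      have a_le n : a n <= a 0%N.
        by elim: n => // n; exact: le_trans.
      by rewrite addnS psumS -natr1; have := a_le (k + m).+1; lra.
    have [n _ /(_ n (leqnn n))] :=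
      (cvgryPge _).1 al ((w 0%N * (m%:R * a 0%N)) / (- psum w m)).
    rewrite ler_pdivrMr ?oppr_gt0 // => an_ge.
    have := w_lb n m; have := ler_wpM2l (ltW w0) (tail n); lra.
  rewrite invey; apply: cvg_EFin; first exact: nearW.
  apply: (squeeze_cvgr (f := cst 0) (h := fun n => (psum a n)^-1)).
  + by apply: nearW => n; rewrite w_ub w_ge.
  + exact: cvg_cst.
  + by apply/gtr0_cvgV0 => //; exact: nearW.
Qed.

Lemma eseries_psum (R : realType) (w : R^nat) (x : \bar R) :
  (psum w n)%:E @[n --> \oo] --> x ->
  ((w 0%N)%:E + \sum_(1 <= j <oo) (w j)%:E)%E = x.
Proof.
move=> wx; rewrite (_ : (\sum_(1 <= j <oo) (w j)%:E)%E = (x - (w 0%N)%:E)%E).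
  by rewrite addeC subeK.
apply: cvg_lim => //; rewrite -cvg_shiftS /=.
have -> : (fun n => (\sum_(1 <= j < n.+1) (w j)%:E)%E) =
    (fun n => ((psum w n)%:E - (w 0%N)%:E)%E).
  apply/funext => n; rewrite sumEFin /psum -(big_mkord predT).
  by rewrite [in RHS]big_ltn // -EFinB [X in (X - _)%:E]addrC addrK.
by apply: (cvgeB _ wx (cvg_cst _)); exact: fin_num_adde_defl.
Qed.

Lemma psum_le_eseries (R : realType) (w : R^nat) (n : nat) :
  (forall n, w n.+1 <= 0) ->
  ((w 0%N)%:E + \sum_(1 <= j <oo) (w j)%:E <= (psum w n)%:E)%E.
Proof.
move=> w_le0.
have /(@ereal_nonincreasing_cvgn R) wx :
    {homo (fun n => (psum w n)%:E) : m n / (m <= n)%N >-> (n <= m)%E}.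
  by move=> k m km; rewrite lee_fin psum_nonincreasing.
by rewrite (eseries_psum wx); apply: ereal_inf_lbound; exists n.
Qed.

Unset Implicit Arguments.

Theorem theorem2p1 (R : realType) (a omega : R^nat) (a0_gt0 : 0 < a 0%N)
    (a_omega : is_conv_inverse a omega) :
  (completely_monotone a <->
    [/\ 0 < omega 0%N,
        completely_monotone (fun k => - omega k.+1) &
        (0 <= (omega 0%N)%:E + \sum_(1 <= j <oo) (omega j)%:E)%E]) /\
  (completely_monotone a ->
    ((omega 0%N)%:E + \sum_(1 <= j <oo) (omega j)%:E = (l1_norm a)^-1)%E).
Proof.
have w0_gt0 : 0 < omega 0%N.
  have : Defs.conv a omega 0%N = 1 by rewrite a_omega.
  by rewrite /Defs.conv big_ord1 => aw; rewrite -(pmulr_rgt0 _ a0_gt0) aw.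
have sumE : completely_monotone a ->
    ((omega 0%N)%:E + \sum_(1 <= j <oo) (omega j)%:E = (l1_norm a)^-1)%E.
  move=> a_cm; have b_cm := inverse_completely_monotone a0_gt0 a_cm a_omega.
  apply: eseries_psum; apply: cvg_inverse_psum => // n.
  - exact: (a_cm 0%N n).
  - by have := a_cm 1%N n; rewrite /= subr_ge0.
  - by have := b_cm 0%N n; rewrite /= oppr_ge0.
split=> //; split=> [a_cm|[_ b_cm sum_ge0]].
  split=> //; first exact: inverse_completely_monotone a0_gt0 a_cm a_omega.
  by rewrite sumE // inve_ge0; apply: nneseries_ge0 => n _ _; rewrite lee_fin.
apply: (completely_monotone_inverse w0_gt0 a_omega b_cm) => n.
have w_le0 k : omega k.+1 <= 0 by have := b_cm 0%N k; rewrite /= oppr_ge0.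
have := le_trans sum_ge0 (psum_le_eseries n w_le0).
rewrite lee_fin /psum big_ord_recl => psum_ge0.
by rewrite sumrN -subr_ge0 opprK.
Qed.
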